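(* Let $L/K$ be a quadratic Galois extension of fields with $K$ of characteristic $\ne2$, $\tau\in\operatorname{Gal}(L/K)$ the non-trivial element, $W_K$ a $K$-vector space, $W_L=L\otimes_KW_K$, $W_+,W_-\subseteq W_L$ two $L$-subspaces, and $\varphi_+\colon W_+\to W_-^\tau$, $\varphi_-\colon W_-\to W_+^\tau$ two $L$-linear isomorphisms with $\varphi_-^\tau\circ\varphi_+=\mathbf 1_{W_+}+n$, where $n$ is nilpotent. Define recursively $\varphi_\pm^{(0)}:=\varphi_\pm$ and \[ \varphi_\pm^{(k+1)}:=\tfrac12\Bigl(\varphi_\pm^{(k)}+\bigl((\varphi_\mp^{(k)})^\tau\bigr)^{-1}\Bigr),\qquad k\ge0. \] Then there exists $k_0\ge0$ such that for all $k\ge k_0$ \[ \varphi_\pm^{(k)}=\varphi_\pm^{(k_0)}\qquad\text{and}\qquad(\varphi_\mp^{(k)})^\tau\circ\varphi_\pm^{(k)}=\mathbf 1_{W_\pm}. \] Addendum: If $W_\pm=W_\mp^\tau$, if $\varphi_\pm\circ\varphi_\mp^\tau=\varphi_\mp^\tau\circ\varphi_\pm$, and if $\varphi_\pm=\mathbf 1_{W_\pm}+m_\pm$ with $m_\pm$ nilpotent, then for all $k\ge0$ \[ \varphi_\pm^{(k)}\circ(\varphi_\mp^{(k)})^\tau=(\varphi_\mp^{(k)})^\tau\circ\varphi_\pm^{(k)}\qquad\text{and}\qquad\varphi_\pm^{(k)}=\mathbf 1_{W_\pm}+m_\pm^{(k)} \] with $m_\pm^{(k)}$ nilpotent.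
   Context: $\tau$ acts on $W_L$ by $\tau(a\otimes w)=\tau(a)\otimes w$. For an $L$-subspace $U\subseteq W_L$, $U^\tau=\tau(U)$. For an $L$-linear map $\phi\colon U\to U'$ between subspaces of $W_L$, $\phi^\tau=\tau\circ\phi\circ\tau^{-1}\colon U^\tau\to U'^\tau$. *)

(* Defs.v *)
From HB Require Import structures.
From mathcomp Require Import all_boot all_order all_algebra all_fingroup all_field.
From mathcomp Require Import generic_quotient ring_quotient freeg.
From mathcomp Require Import mathcomp_extra boolp classical_sets functions.

Set Implicit Arguments.
Unset Strict Implicit.
Unset Printing Implicit Defensive.

Import GRing.Theory.
Local Open Scope ring_scope.
Local Open Scope quotient_scope.
Local Open Scope classical_set_scope.

(* The tensor product of two K-modules: the free K-module on the set A * W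
   modulo the submodule spanned by the bilinearity relations. *)
Section Tensor.
Variables (K : fieldType) (A W : lmodType K).

Notation free := {freeg (A * W)%type / K}.

Definition tens_gen (a : A) (w : W) : free := << (a, w) >>.

Inductive bilin_span : free -> Prop :=
| Span0 : bilin_span 0
| SpanP c x y : bilin_span x -> bilin_span y -> bilin_span (c *: x + y)
| SpanL c a a' w : bilin_span (tens_gen (c *: a + a') w - (c *: tens_gen a w + tens_gen a' w))
| SpanR c a w w' : bilin_span (tens_gen a (c *: w + w') - (c *: tens_gen a w + tens_gen a w')).

Definition bilin_rel (x : free) : bool := `[< bilin_span x >].

Lemma bilin_rel_closed : zmod_closed bilin_rel.
Proof.
split=> [|x y /asboolP xS /asboolP yS]; apply/asboolP; first exact: Span0.
by rewrite addrC -scaleN1r; apply: SpanP.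
Qed.

HB.instance Definition _ := GRing.isZmodClosed.Build free bilin_rel bilin_rel_closed.

Definition bilin_sub : zmodClosed free := GRing.ZmodClosed.clone _ bilin_rel _.

Definition tensor := Quotient.quot bilin_sub.

HB.instance Definition _ := GRing.Zmodule.on tensor.
HB.instance Definition _ := ZmodQuotient.on tensor.

Definition tens (a : A) (w : W) : tensor := \pi_tensor (tens_gen a w).

Lemma pi_tensor_eq (x y : free) : \pi_tensor x = \pi_tensor y <-> bilin_span (x - y).
Proof.
split=> [/eqP|xy]; last apply/eqP; rewrite -Quotient.idealrBE.
  by move/asboolP.
exact/asboolP.
Qed.

Lemma tensorW (P : tensor -> Prop) :
  (forall x, P (\pi_tensor x)) -> forall t, P t.
Proof. by move=> Ppi t; rewrite -[t]reprK. Qed.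

Lemma bilin_spanZ c x : bilin_span x -> bilin_span (c *: x).
Proof. by move=> xS; rewrite -[_ *: _]addr0; apply: SpanP => //; apply: Span0. Qed.

Definition tensor_scale c (t : tensor) : tensor := \pi_tensor (c *: repr t).

Lemma pi_tensor_scale c x : \pi_tensor (c *: x) = tensor_scale c (\pi_tensor x).
Proof.
apply/pi_tensor_eq; rewrite -scalerBr; apply: bilin_spanZ.
by apply/pi_tensor_eq; rewrite reprK.
Qed.

Fact tensor_scaleA a b t : tensor_scale a (tensor_scale b t) = tensor_scale (a * b) t.
Proof. by elim/tensorW: t => x; rewrite -!pi_tensor_scale scalerA. Qed.
Fact tensor_scale1 : left_id 1 tensor_scale.
Proof. by elim/tensorW=> x; rewrite -pi_tensor_scale scale1r. Qed.
Fact tensor_scaleDr : right_distributive tensor_scale +%R.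
Proof.
move=> c; elim/tensorW=> x; elim/tensorW=> y.
by rewrite -raddfD -!pi_tensor_scale scalerDr raddfD.
Qed.
Fact tensor_scaleDl t : {morph tensor_scale^~ t : a b / a + b}.
Proof.
by move=> a b; elim/tensorW: t => x; rewrite -!pi_tensor_scale scalerDl raddfD.
Qed.

HB.instance Definition _ := GRing.Zmodule_isLmodule.Build K tensor
  tensor_scaleA tensor_scale1 tensor_scaleDr tensor_scaleDl.

Lemma tensPl c a a' w : tens (c *: a + a') w = c *: tens a w + tens a' w.
Proof.
by rewrite /tens /GRing.scale/= -pi_tensor_scale -raddfD; apply/pi_tensor_eq/SpanL.
Qed.

Lemma tensPr c a w w' : tens a (c *: w + w') = c *: tens a w + tens a w'.
Proof.
by rewrite /tens /GRing.scale/= -pi_tensor_scale -raddfD; apply/pi_tensor_eq/SpanR.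
Qed.

End Tensor.

(* The universal property of the tensor product. *)
Section TensorLift.
Variables (K : fieldType) (A W Z : lmodType K) (f : A -> W -> Z).
Hypothesis fPl : forall w, linear (f^~ w).
Hypothesis fPr : forall a, linear (f a).

Notation free := {freeg (A * W)%type / K}.
Definition liftf (x : free) : Z := fglift (fun aw : A * W => f aw.1 aw.2) x.

Lemma freegZ (c k : K) (x : A * W) : c *: << k *g x >> = << (c * k) *g x >>.
Proof. by apply/eqP/freeg_eqP => y; rewrite coeffZ !coeffU mulrA. Qed.

Fact liftf_is_linear : linear liftf.
Proof.
have liftB x y : liftf (x - y) = liftf x - liftf y by exact: lift_is_additive.
have lift0 : liftf 0 = 0 by rewrite -(subrr 0) liftB subrr.
have liftN y : liftf (- y) = - liftf y by rewrite -sub0r liftB lift0 sub0r.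
have liftD x y : liftf (x + y) = liftf x + liftf y.
  by rewrite -{1}[y]opprK liftB liftN opprK.
move=> c x y; rewrite liftD; congr (_ + _).
rewrite -[x]freeg_sumE scaler_sumr.
rewrite !(big_morph _ liftD lift0) scaler_sumr; apply: eq_bigr => z _.
by rewrite freegZ /liftf !liftU scalerA.
Qed.

HB.instance Definition _ := GRing.isLinear.Build K free Z *:%R liftf liftf_is_linear.

Lemma liftf_gen a w : liftf (tens_gen a w) = f a w.
Proof. by rewrite /liftf /tens_gen liftU scale1r. Qed.

Lemma liftf_span x : bilin_span x -> liftf x = 0.
Proof.
elim=> [|c {}x y _ Sx _ Sy|c a a' w|c a w w'].
- exact: raddf0.
- by rewrite linearP /= Sx Sy scaler0 addr0.
- by rewrite linearB linearP /= !liftf_gen fPl subrr.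
- by rewrite linearB linearP /= !liftf_gen fPr subrr.
Qed.

Definition tensor_lift (t : tensor A W) : Z := liftf (repr t).

Lemma tensor_lift_pi x : tensor_lift (\pi_(tensor A W) x) = liftf x.
Proof.
have /pi_tensor_eq/liftf_span : \pi_(tensor A W) x = \pi_(tensor A W) (repr (\pi_(tensor A W) x)).
  by rewrite reprK.
by rewrite raddfB => /subr0_eq.
Qed.

Lemma tensor_lift_tens a w : tensor_lift (tens a w) = f a w.
Proof. by rewrite tensor_lift_pi liftf_gen. Qed.

Fact tensor_lift_is_linear : linear tensor_lift.
Proof.
move=> c; elim/tensorW=> x; elim/tensorW=> y.
rewrite /GRing.scale/= -pi_tensor_scale.
by rewrite -raddfD !tensor_lift_pi linearP.
Qed.

HB.instance Definition _ := GRing.isLinear.Build K (tensor A W) Z *:%R tensor_lift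
  tensor_lift_is_linear.
End TensorLift.

(* Pure tensors span, so linear maps out of A (x)_K W are determined by them. *)
Lemma tensor_ext (K : fieldType) (A W Z : lmodType K)
    (g h : {linear tensor A W -> Z}) :
  (forall a w, g (tens a w) = h (tens a w)) -> g =1 h.
Proof.
move=> gh; elim/tensorW => x; rewrite -[x]freeg_sumE !raddf_sum /=.
apply: eq_bigr => -[a w] _.
have -> : << coeff (a, w) x *g (a, w) >> = coeff (a, w) x *: tens_gen a w :> {freeg (A * W) / K}.
  by rewrite /tens_gen freegZ mulr1.
have -> : \pi_(tensor A W) (coeff (a, w) x *: tens_gen a w) = coeff (a, w) x *: tens a w.
  exact: pi_tensor_scale.
by rewrite !linearZ /= gh.
Qed.

Section TensorMap.
Variables (K : fieldType) (A B W : lmodType K) (g : {linear A -> B}).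

Fact tens_mapPl (w : W) : linear (fun a => tens (g a) w).
Proof. by move=> c a a'; rewrite linearP tensPl. Qed.

Fact tens_mapPr (a : A) : linear (fun w : W => tens (g a) w).
Proof. by move=> c w w'; rewrite tensPr. Qed.

Definition tens_map : tensor A W -> tensor B W :=
  tensor_lift (fun a w => tens (g a) w).

HB.instance Definition _ := GRing.isLinear.Build K (tensor A W) (tensor B W) *:%R
  tens_map (tensor_lift_is_linear tens_mapPl tens_mapPr).

Lemma tens_map_tens a w : tens_map (tens a w) = tens (g a) w.
Proof. exact: (tensor_lift_tens tens_mapPl tens_mapPr). Qed.
End TensorMap.

(* L (x)_K W as an L-module, with scalar action a *: (b (x) w) = (a * b) (x) w. *)
Definition base_change (K : fieldType) (L : fieldExtType K) (W : lmodType K) : Type :=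
  tensor L W.

Section BaseChange.
Variables (K : fieldType) (L : fieldExtType K) (W : lmodType K).

HB.instance Definition _ := GRing.Zmodule.on (base_change L W).

Definition base_scale (a : L) : base_change L W -> base_change L W :=
  tens_map (W := W) (amull a).

Fact base_scaleA a b t : base_scale a (base_scale b t) = base_scale (a * b) t.
Proof.
apply: (tensor_ext (g := tens_map (W := W) (amull a) \o tens_map (W := W) (amull b))) => c w.
by rewrite /= !tens_map_tens /amull /= !lfunE /= mulrA.
Qed.

Fact base_scale1 : left_id 1 base_scale.
Proof.
apply: (tensor_ext (h := idfun)) => c w.
by rewrite /= tens_map_tens /amull /= lfunE /= mul1r.
Qed.

Fact base_scaleDr : right_distributive base_scale +%R.
Proof. by move=> a x y; rewrite /base_scale raddfD. Qed.

Fact base_scaleDl t : {morph base_scale^~ t : a b / a + b}.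
Proof.
move=> a b.
apply: (tensor_ext (h := tens_map (W := W) (amull a) \+ tens_map (W := W) (amull b))) => c w.
rewrite /= !tens_map_tens /amull /= !lfunE /= mulrDl -[a * c]scale1r tensPl.
by rewrite !scale1r.
Qed.

HB.instance Definition _ := GRing.Zmodule_isLmodule.Build L (base_change L W)
  base_scaleA base_scale1 base_scaleDr base_scaleDl.

Lemma base_scale_tens (a b : L) (w : W) :
  a *: (tens b w : base_change L W) = tens (a * b) w.
Proof. by rewrite [LHS]tens_map_tens /amull /= lfunE. Qed.
End BaseChange.

Section GaloisAction.
Variables (K : fieldType) (L : splittingFieldType K) (W : lmodType K).
Variable tau : gal_of {:L}.

Definition gal_act : base_change L W -> base_change L W :=
  tens_map (W := W) (tau : 'End(L)).

Lemma gal_act_tens a w : gal_act (tens a w) = tens (tau a) w.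
Proof. exact: tens_map_tens. Qed.
End GaloisAction.

(* phi^tau = tau o phi o tau^-1. *)
Definition gal_conj (K : fieldType) (L : splittingFieldType K) (W : lmodType K)
    (tau : gal_of {:L}) (phi : base_change L W -> base_change L W) :=
  gal_act tau \o phi \o gal_act (tau^-1)%g.

(* Maps between subspaces of V are represented by functions V -> V whose values
   off the source subspace are irrelevant. *)
Section Subspaces.
Variables (F : fieldType) (V : lmodType F).
Implicit Types (U : set V) (f n : V -> V).

Definition subspace U := GRing.submod_closed [in U].

Definition linear_on U (U' : set V) f :=
  set_fun U U' f /\
  forall a : F, {in U &, forall x y, f (a *: x + y) = a *: f x + f y}.

Definition linear_iso_on U (U' : set V) f := linear_on U U' f /\ set_bij U U' f.

Definition nilpotent_on U n :=
  linear_on U U n /\ exists N : nat, {in U, forall x, iter N n x = 0}.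
End Subspaces.

(* The signs + and - are true and false. At step k.+1, the inverse is that of
   (phi_(-s)^(k))^tau : (W_(-s))^tau -> W_s. *)
Fixpoint phi_iter (K : fieldType) (L : splittingFieldType K) (WK : lmodType K)
    (tau : gal_of {:L}) (W : bool -> set (base_change L WK))
    (phi : bool -> base_change L WK -> base_change L WK) (k : nat) (s : bool) :
    base_change L WK -> base_change L WK :=
  if k is k'.+1 then fun x =>
    (2%:R^-1 : L) *: (phi_iter tau W phi k' s x +
      'pinv_(fun=> 0) (gal_act tau @` W (~~ s))
        (gal_conj tau (phi_iter tau W phi k' (~~ s))) x)
  else phi s.

(* Main.v *)
Require Import Defs.
From HB Require Import structures.
From mathcomp Require Import all_boot all_order all_algebra all_fingroup all_field.
From mathcomp Require Import cyclic.
From mathcomp Require Import mathcomp_extra boolp classical_sets functions.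

Set Implicit Arguments.
Unset Strict Implicit.
Unset Printing Implicit Defensive.

Import GRing.Theory.
Local Open Scope ring_scope.
Local Open Scope classical_set_scope.

(** Put f = phi_+ and g = phi_-^tau, a pair of isomorphisms in opposite
directions with g f = 1 + n.  The conjugate by tau of the recursion for phi_-
is the recursion for g, so that one step is
[[
      f' = (f + g^-1) / 2,        g' = (g + f^-1) / 2 .
]]
This is Newton's iteration for making f and g inverse to each other: since
f^-1 g^-1 = (g f)^-1,
[[
      g' f' = (g f + 2 + (g f)^-1) / 4 = 1 + (g f)^-1 n^2 / 4 ,
]]
and the two factors of the nilpotent part commute.  The exponent that kills
the nilpotent part is therefore halved at every step (inv_mean_unip).  Moreover
f' = g^-1 (1 + n / 2) is again an isomorphism (inv_mean_iso), which keeps the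
recursion going.  Once the exponent is 1 we have g f = 1, hence g^-1 = f and
the sequence is stationary.

For the addendum, f and g are commuting unipotent automorphisms of one space.
The inverse of a unipotent map is unipotent (unip_inv_on), and the nilpotent
part of f' is half the sum of the commuting nilpotent parts of f and g^-1
(unip_inv_mean); commutation persists because all of f, g, f^-1, g^-1 commute
(inv_mean_comm).

The generic part deals with subspaces of a vector space over any field in
which 2 is invertible.  The Galois action enters only as a semilinear
involution, through which images and conjugates of all of these notions are
transported. *)

(** * Linear maps on subspaces *)

Section LinearOn.
Variables (F : fieldType) (V : lmodType F).
Implicit Types (U : set V) (a c : F) (f g h n u : V -> V) (x y z : V).

Lemma subspace0 U : subspace U -> U 0.
Proof. by case=> U0 _; apply/set_mem. Qed.

Lemma subspaceP U a x y : subspace U -> U x -> U y -> U (a *: x + y).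
Proof. by case=> _ UP Ux Uy; apply/set_mem/UP; apply/mem_set. Qed.

Lemma subspaceD U x y : subspace U -> U x -> U y -> U (x + y).
Proof. by move=> sU Ux Uy; rewrite -[x]scale1r; apply: subspaceP. Qed.

Lemma subspaceZ U a x : subspace U -> U x -> U (a *: x).
Proof.
move=> sU Ux; rewrite -[_ *: _]addr0.
by apply: subspaceP => //; apply: subspace0.
Qed.

Lemma subspaceB U x y : subspace U -> U x -> U y -> U (x - y).
Proof. by move=> sU Ux Uy; rewrite addrC -scaleN1r; apply: subspaceP. Qed.

Lemma linear_on_fun U U' f x : linear_on U U' f -> U x -> U' (f x).
Proof. by case=> ff _; apply: ff. Qed.

Lemma linear_onP U U' f a x y : linear_on U U' f -> U x -> U y ->
  f (a *: x + y) = a *: f x + f y.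
Proof. by case=> _ fP Ux Uy; apply: fP; apply/mem_set. Qed.

Lemma linear_onD U U' f x y : linear_on U U' f -> U x -> U y ->
  f (x + y) = f x + f y.
Proof.
by move=> lf Ux Uy; rewrite -[x in LHS]scale1r (linear_onP _ lf) // scale1r.
Qed.

Lemma linear_on0 U U' f : subspace U -> linear_on U U' f -> f 0 = 0.
Proof.
move=> /subspace0 U0 lf; have := linear_onD lf U0 U0.
by rewrite addr0 -{1}[f 0]addr0 => /addrI.
Qed.

Lemma linear_onZ U U' f a x : subspace U -> linear_on U U' f -> U x ->
  f (a *: x) = a *: f x.
Proof.
move=> sU lf Ux; have U0 := subspace0 sU.
by rewrite -[a *: x]addr0 (linear_onP _ lf) // (linear_on0 sU lf) addr0.
Qed.

Lemma linear_onB U U' f x y : linear_on U U' f -> U x -> U y ->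
  f (x - y) = f x - f y.
Proof.
move=> lf Ux Uy.
by rewrite addrC -scaleN1r (linear_onP _ lf) // scaleN1r addrC.
Qed.

Lemma linear_onN U U' f x : subspace U -> linear_on U U' f -> U x ->
  f (- x) = - f x.
Proof. by move=> sU lf Ux; rewrite -!scaleN1r (linear_onZ _ sU lf). Qed.

Lemma eq_linear_on U U' f g : subspace U -> (forall x, U x -> g x = f x) ->
  linear_on U U' f -> linear_on U U' g.
Proof.
move=> sU fg lf; split=> [x Ux|a x y /set_mem Ux /set_mem Uy].
  by rewrite fg //; apply: linear_on_fun lf Ux.
by rewrite !fg ?(linear_onP _ lf) //; apply: subspaceP.
Qed.

Lemma linear_on_comp U U' U'' f g :
  linear_on U U' f -> linear_on U' U'' g -> linear_on U U'' (g \o f).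
Proof.
move=> lf lg; split=> [x Ux|a x y /set_mem Ux /set_mem Uy] /=.
  exact/(linear_on_fun lg)/(linear_on_fun lf).
by rewrite (linear_onP _ lf) // (linear_onP _ lg) //; apply: (linear_on_fun lf).
Qed.

Lemma linear_on_add U U' f g : subspace U' ->
  linear_on U U' f -> linear_on U U' g -> linear_on U U' (fun x => f x + g x).
Proof.
move=> sU' lf lg; split=> [x Ux|a x y /set_mem Ux /set_mem Uy] /=.
  apply: subspaceD => //.
    exact: linear_on_fun lf _.
  exact: linear_on_fun lg _.
by rewrite (linear_onP _ lf) // (linear_onP _ lg) // scalerDr addrACA.
Qed.

Lemma linear_on_scale U U' f c : subspace U' ->
  linear_on U U' f -> linear_on U U' (fun x => c *: f x).
Proof.
move=> sU' lf; split=> [x Ux|a x y /set_mem Ux /set_mem Uy] /=.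
  by apply: subspaceZ => //; apply: linear_on_fun lf _.
by rewrite (linear_onP _ lf) // scalerDr !scalerA mulrC.
Qed.

Lemma linear_on_id U : linear_on U U id.
Proof. by split=> [x|]. Qed.

Lemma linear_on_opp U U' f : subspace U' ->
  linear_on U U' f -> linear_on U U' (fun x => - f x).
Proof.
move=> sU' /(linear_on_scale (-1) sU'); congr linear_on.
by apply/funext=> x; rewrite scaleN1r.
Qed.

Lemma linear_on_sub U U' f g : subspace U' ->
  linear_on U U' f -> linear_on U U' g -> linear_on U U' (fun x => f x - g x).
Proof. by move=> sU' lf /(linear_on_opp sU'); apply: linear_on_add. Qed.

Lemma linear_iso_on_comp U U' U'' f g :
  linear_iso_on U U' f -> linear_iso_on U' U'' g ->
  linear_iso_on U U'' (g \o f).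
Proof.
move=> [lf bf] [lg bg].
by split; [apply: linear_on_comp lf lg|apply: set_bij_comp bf bg].
Qed.

Lemma iso_linear U U' f : linear_iso_on U U' f -> linear_on U U' f.
Proof. by case. Qed.

Lemma iso_inj U U' f x y : linear_iso_on U U' f -> U x -> U y ->
  f x = f y -> x = y.
Proof. by case=> _ [_ fi _] Ux Uy; apply: fi; apply/mem_set. Qed.

Lemma eq_linear_iso_on U U' f g : subspace U -> (forall x, U x -> g x = f x) ->
  linear_iso_on U U' f -> linear_iso_on U U' g.
Proof.
move=> sU fg [lf [_ fi fs]].
have lg := eq_linear_on sU fg lf; split=> //; split.
- exact: lg.1.
- move=> x y /set_mem Ux /set_mem Uy; rewrite !fg //.
  by apply: fi; apply/mem_set.
- by move=> y /fs[x Ux <-]; exists x; rewrite ?fg.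
Qed.

Definition inv_on U g : V -> V := 'pinv_(fun=> 0) U g.

Lemma inv_onK U U' g x : linear_iso_on U U' g -> U x -> inv_on U g (g x) = x.
Proof. by case=> _ [_ gi _] Ux; exact: (pinvKV (fun=> 0) gi (mem_set Ux)). Qed.

Lemma inv_onKV U U' g y : linear_iso_on U U' g -> U' y -> g (inv_on U g y) = y.
Proof.
case=> _ [_ _ gs] Uy.
exact: (@surjpK _ _ (fun=> 0) _ _ _ gs _ (mem_set Uy)).
Qed.

(** The inverse is linear because a x + y is the image under g of
    a g^-1 x + g^-1 y. *)
Lemma inv_on_iso U U' g : subspace U -> linear_iso_on U U' g ->
  linear_iso_on U' U (inv_on U g).
Proof.
move=> sU ig; have [lg bg] := ig; have bi := bijpinv_bij (fun=> 0) bg.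
split=> //; split=> [|a x y /set_mem Ux /set_mem Uy]; first by case: bi.
have Ui z : U' z -> U (inv_on U g z) by case: bi => bf _ _; apply: bf.
have <- : g (a *: inv_on U g x + inv_on U g y) = a *: x + y.
  by rewrite (linear_onP _ lg) ?(inv_onKV ig) //; apply: Ui.
by rewrite (inv_onK ig) //; apply: subspaceP; auto.
Qed.

Lemma eq_inv_on U U' g h y : linear_iso_on U U' g -> U' y ->
  U (h y) -> g (h y) = y -> inv_on U g y = h y.
Proof. by move=> ig Uy Uh E; rewrite -{1}E (inv_onK ig). Qed.

(** * Nilpotent maps with a bound on the exponent *)

(** The number of steps after which the iteration stops is read off from the
    exponent, so that it is recorded here rather than quantified away. *)
Definition nil_index N U n :=
  linear_on U U n /\ forall x, U x -> iter N n x = 0.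

Lemma nilpotent_onP U n : nilpotent_on U n <-> exists N, nil_index N U n.
Proof.
split=> [[ln [N nN]]|[N [ln nN]]]; [exists N|split=> //; exists N].
  by split=> // x Ux; apply/nN/mem_set.
by move=> x /set_mem; apply: nN.
Qed.

Lemma iter_linear U n N : linear_on U U n -> linear_on U U (iter N n).
Proof.
move=> ln; elim: N => [|N IH]; first exact: linear_on_id.
exact: linear_on_comp IH ln.
Qed.

Lemma eq_nil_index N U n n' : subspace U -> (forall x, U x -> n' x = n x) ->
  nil_index N U n -> nil_index N U n'.
Proof.
move=> sU nn' [ln nN]; split; first exact: eq_linear_on ln.
move=> x Ux; rewrite -(nN x Ux); elim: N {nN} => //= N ->.
by apply/nn'/(linear_on_fun (iter_linear N ln)).
Qed.

Lemma nil_index_le M N U n : subspace U -> (M <= N)%N ->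
  nil_index M U n -> nil_index N U n.
Proof.
move=> sU MN [ln nM]; split=> // x Ux.
by rewrite -(subnK MN) iterD nM // (linear_on0 sU (iter_linear _ ln)).
Qed.

Lemma nil_index_sqr m U n : nil_index m.*2 U n -> nil_index m U (n \o n).
Proof.
move=> [ln n2m]; split; first exact: (linear_on_comp ln ln).
move=> x Ux; rewrite -(n2m x Ux).
by elim: m {n2m} => //= m ->.
Qed.

Lemma nil_index_comp N U n u :
  subspace U -> nil_index N U n -> linear_on U U u ->
  (forall x, U x -> u (n x) = n (u x)) -> nil_index N U (u \o n).
Proof.
move=> sU [ln nN] lu un; split; first exact: linear_on_comp ln lu.
have iU k x : U x -> U (iter k u x) by apply: linear_on_fun; apply: iter_linear.
have jU k x : U x -> U (iter k n x) by apply: linear_on_fun; apply: iter_linear.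
suff E k x : U x -> iter k (u \o n) x = iter k u (iter k n x).
  by move=> x Ux; rewrite E // nN // (linear_on0 sU (iter_linear _ lu)).
move=> Ux; elim: k => //= k ->; congr (u _).
have: U (iter k n x) by exact: jU.
by elim: k (iter k n x) => //= k IH y Uy; rewrite -un ?IH //; apply: iU.
Qed.

(** A crude substitute for the binomial theorem: by induction on p + q, the sum
    n + u of commuting maps kills in p + q steps any vector killed by n^p and by
    u^q, since n x is killed by n^(p-1) and u^q, and u x by n^p and u^(q-1). *)
Lemma nil_index_add (p q : nat) U n u :
  subspace U -> nil_index p U n -> nil_index q U u ->
  (forall x, U x -> u (n x) = n (u x)) ->
  nil_index (p + q) U (fun x => n x + u x).
Proof.
move=> sU [ln np] [lu uq] un.
have lnu := linear_on_add sU ln lu; split=> // x Ux.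
have nU y : U y -> U (n y) by apply: linear_on_fun ln.
have uU y : U y -> U (u y) by apply: linear_on_fun lu.
have un_iter k y : U y -> iter k u (n y) = n (iter k u y).
  move=> Uy; elim: k => //= k ->; rewrite un //.
  exact: linear_on_fun (iter_linear k lu) _.
have nu_iter k y : U y -> iter k n (u y) = u (iter k n y).
  move=> Uy; elim: k => //= k ->; rewrite un //.
  exact: linear_on_fun (iter_linear k ln) _.
set s := fun x => _; have iter0 N : iter N s 0 = 0.
  exact/(linear_on0 sU)/iter_linear/lnu.
have: iter p n x = 0 by exact: np.
have: iter q u x = 0 by exact: uq.
move: (leqnn (p + q)); move: {2 3}(p + q)%N => N.
elim: N p q x Ux {np uq} => [|N IH] [|p] [|q] x Ux // pqN qx px;
  try by rewrite (_ : x = 0).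
have [Unx Uux] := (nU x Ux, uU x Ux).
rewrite iterSr (linear_onD (iter_linear N lnu)) //.
rewrite (IH p q.+1) ?(IH p.+1 q) ?addr0 //.
- by rewrite -ltnS -addnS.
- by rewrite -iterSr.
- by rewrite nu_iter // px (linear_on0 sU lu).
- by rewrite un_iter // qx (linear_on0 sU ln).
- by rewrite -iterSr.
Qed.
End LinearOn.

(** * The mean of a map and an inverse *)

Section InvMean.
Variables (F : fieldType) (V : lmodType F).
Hypothesis two_neq0 : 2%:R != 0 :> F.
Implicit Types (U : set V) (e f g h n u : V -> V) (x y z : V).

Definition unip_index N U e := nil_index N U (fun x => e x - x).

Lemma half_double x : 2%:R^-1 *: (x + x) = x :> V.
Proof. by rewrite -mulr2n -scaler_nat scalerA mulVf // scale1r. Qed.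

(** If x + c n x = 0, applying n^j shows that n^(j+1) x = 0 forces n^j x = 0,
    which gives injectivity by descent.  For surjectivity, a preimage of x is
    x - c y, where y is a preimage of n x: induct on the exponent killing x. *)
Lemma unipotent_iso N U n (c : F) : subspace U -> nil_index N U n ->
  linear_iso_on U U (fun x => x + c *: n x).
Proof.
move=> sU [ln nN].
have lf : linear_on U U (fun x => x + c *: n x).
  by apply: linear_on_add => //; [apply: linear_on_id|apply: linear_on_scale].
have nU y : U y -> U (n y) by apply: linear_on_fun ln.
split=> //; split; first exact: lf.1.
- have inj0 x : U x -> x + c *: n x = 0 -> x = 0.
    move=> Ux xn0; suff: forall j, iter j n x = 0 -> x = 0 by apply; apply: nN.
    elim=> // j IH nj; apply: IH.
    have := congr1 (iter j n) xn0.
    have lj := iter_linear j ln; have nx := nU x Ux.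
    rewrite (linear_onD lj) ?(linear_onZ _ sU lj) ?(linear_on0 sU lj) //;
      last exact: subspaceZ.
    by rewrite -iterSr nj scaler0 addr0.
  move=> x y /set_mem Ux /set_mem Uy E; apply/subr0_eq/inj0.
    exact: subspaceB.
  by rewrite (linear_onB ln) // scalerBr addrACA -opprD E subrr.
- suff sur j x : U x -> iter j n x = 0 -> exists2 y, U y & y + c *: n y = x.
    by move=> x Ux; apply: (sur N) => //; apply: nN.
  elim: j x => [|j IH] x Ux.
    move=> /= ->; exists 0; rewrite ?(linear_on0 sU ln) ?scaler0 ?addr0 //.
    exact: subspace0.
  rewrite iterSr => /(IH _ (nU x Ux))[y Uy yn].
  exists (x - c *: y); first by apply: subspaceB => //; apply: subspaceZ.
  rewrite (linear_onB ln) ?(linear_onZ _ sU ln) //; last exact: subspaceZ.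
  by rewrite -addrA -scalerN -scalerDr addrCA -opprD yn subrr scaler0 addr0.
Qed.

(** The maps g f and f g are conjugate through f, hence so are their nilpotent
    parts. *)
Lemma unip_rotate N U U' f g : subspace U -> subspace U' ->
  linear_iso_on U U' f -> linear_on U' U g -> unip_index N U (g \o f) ->
  unip_index N U' (f \o g).
Proof.
move=> sU sU' isof lg [ln nN]; have lf := iso_linear isof.
split=> [|y Uy].
  by apply: linear_on_sub (linear_on_comp lg lf) (linear_on_id _).
have [_ [_ _ fs]] := isof; have [x Ux <-] := fs _ Uy.
suff -> : iter N (fun y => (f \o g) y - y) (f x) =
    f (iter N (fun x => (g \o f) x - x) x).
  by rewrite nN // (linear_on0 sU lf).
elim: N {nN} => //= j ->; have Uj := linear_on_fun (iter_linear j ln) Ux.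
rewrite (linear_onB lf) //.
exact/(linear_on_fun lg)/(linear_on_fun lf).
Qed.

(** One step of the recursion: the mean of f and of the inverse of g, where g is
    defined on U' and goes in the direction opposite to f. *)
Definition inv_mean U' f g := fun x => 2%:R^-1 *: (f x + inv_on U' g x) : V.

Section Pair.
Variables (U U' : set V) (f g : V -> V).
Hypotheses (sU : subspace U) (sU' : subspace U').
Hypotheses (isof : linear_iso_on U U' f) (isog : linear_iso_on U' U g).

Let lf := iso_linear isof.
Let lg := iso_linear isog.
Let invf := inv_on U f.
Let invg := inv_on U' g.
Let linvf : linear_on U' U invf := iso_linear (inv_on_iso sU isof).
Let linvg : linear_on U U' invg := iso_linear (inv_on_iso sU' isog).
Let fU x : U x -> U' (f x) := linear_on_fun lf.
Let gU y : U' y -> U (g y) := linear_on_fun lg.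
Let invfU y : U' y -> U (invf y) := linear_on_fun linvf.
Let invgU x : U x -> U' (invg x) := linear_on_fun linvg.

(** The mean of f and g^-1 is g^-1 (1 + n / 2), where n = g f - 1. *)
Lemma inv_mean_iso N : unip_index N U (g \o f) ->
  linear_iso_on U U' (inv_mean U' f g).
Proof.
move=> nN; have iso1 := unipotent_iso 2%:R^-1 sU nN.
have iso2 := linear_iso_on_comp iso1 (inv_on_iso sU' isog).
apply: eq_linear_iso_on iso2 => // x Ux.
have fx := fU Ux; have gx := gU fx; have sx := subspaceB sU gx Ux.
rewrite /inv_mean /= -/invg (linear_onD linvg) ?(linear_onZ _ sU linvg) //;
  last exact: subspaceZ.
rewrite (linear_onB linvg) //.
rewrite [invg (g _)](inv_onK isog) // -{2}[invg x]half_double -scalerDr.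
by congr (_ *: _); rewrite addrACA subrr addr0 addrC.
Qed.

(** With n = g f - 1, the new nilpotent part is u n^2 for u = (g f)^-1 / 4,
    which commutes with n. *)
Lemma inv_mean_unip m : unip_index m.*2 U (g \o f) ->
  unip_index m U (inv_mean U g f \o inv_mean U' f g).
Proof.
move=> nm; have n2 := nil_index_sqr nm; set n := fun x => _ in nm n2.
pose u x := 4%:R^-1 *: invf (invg x).
have ln : linear_on U U n by case: nm.
have lu : linear_on U U u.
  exact/linear_on_scale/(linear_on_comp linvg linvf).
have nU x : U x -> U (n x) by apply: linear_on_fun ln.
have invE x : U x -> invf (invg (g (f x))) = x.
  by move=> Ux; rewrite [invg _](inv_onK isog) ?[invf _](inv_onK isof) //; auto.
have Einv x : U x -> g (f (invf (invg x))) = x.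
  by move=> Ux; rewrite (inv_onKV isof) ?(inv_onKV isog) //; auto.
have invnE x : U x -> invf (invg (n x)) = x - invf (invg x).
  move=> Ux; rewrite /n (linear_onB linvg) ?(linear_onB linvf) ?invE //=; auto.
have un x : U x -> u (n x) = n (u x).
  move=> Ux; have Uw : U (invf (invg x)) by auto.
  rewrite /u (linear_onZ _ sU ln) // invnE // /n /= Einv //.
apply: eq_nil_index (nil_index_comp sU n2 lu _) => //; last first.
  by move=> x Ux; rewrite /= !un //; auto.
(* It remains to check that (e + 2 + w) / 4 - 1 = (e - 2 + w) / 4, where e is
   g f and w its inverse. *)
move=> x Ux; have [fx gx kx] := And3 (fU Ux) (invgU Ux) (invfU (invgU Ux)).
rewrite /= /u invnE; last exact: nU.
rewrite invnE // /n /inv_mean /= -/invf -/invg.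
have sx := subspaceD sU' fx gx.
rewrite (linear_onZ _ sU' lg) // [invf _](linear_onZ _ sU' linvf) //.
rewrite (linear_onD lg) // (linear_onD linvf) // [g (invg _)](inv_onKV isog) //.
rewrite [invf (f x)](inv_onK isof) //.
set e := g (f x); set w := invf _.
rewrite -scalerDr scalerA -invfM -natrM -{3}[x]half_double.
rewrite -[X in _ - X]half_double -!scalerDr !scalerA -invfM -natrM -scalerBr.
have collect y : y + x - (x + x) = y - x by rewrite opprD addrA addrK.
by rewrite opprB opprD addrACA [x + w]addrC !collect.
Qed.

End Pair.

Lemma comm_inv_on U f g x : subspace U -> linear_on U U f ->
  linear_iso_on U U g -> (forall y, U y -> f (g y) = g (f y)) ->
  U x -> f (inv_on U g x) = inv_on U g (f x).
Proof.
move=> sU lf isog fgC Ux.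
have Uh := linear_on_fun (iso_linear (inv_on_iso sU isog)) Ux.
rewrite -[in RHS](inv_onKV isog Ux) fgC // (inv_onK isog) //.
exact: linear_on_fun lf _.
Qed.

(** The nilpotent part of g^-1 is g^-1 - 1 = - g^-1 (g - 1), and the two factors
    commute. *)
Lemma unip_inv_on N U g : subspace U -> linear_iso_on U U g ->
  unip_index N U g -> unip_index N U (inv_on U g).
Proof.
move=> sU isog ng; have lg := iso_linear isog.
have gU x : U x -> U (g x) by apply: linear_on_fun lg.
have lh := iso_linear (inv_on_iso sU isog).
have hU x : U x -> U (inv_on U g x) by apply: linear_on_fun lh.
have E x : U x -> - inv_on U g (g x - x) = inv_on U g x - x.
  by move=> Ux; rewrite (linear_onB lh) ?(inv_onK isog) ?opprB //; exact: gU.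
apply: eq_nil_index (nil_index_comp sU ng (linear_on_opp sU lh) _) => //.
  by move=> x Ux; rewrite /= E.
move=> x Ux; rewrite E // (linear_onN sU lg) ?(inv_onKV isog) ?opprK 1?addrC //.
exact: hU.
Qed.

Section Commuting.
Variables (U : set V) (f g : V -> V).
Hypotheses (sU : subspace U).
Hypotheses (isof : linear_iso_on U U f) (isog : linear_iso_on U U g).
Hypothesis fgC : forall x, U x -> f (g x) = g (f x).

Let lf := iso_linear isof.
Let lg := iso_linear isog.
Let lh := iso_linear (inv_on_iso sU isog).
Let lk := iso_linear (inv_on_iso sU isof).
Let fU x : U x -> U (f x) := linear_on_fun lf.
Let gU x : U x -> U (g x) := linear_on_fun lg.
Let hU x : U x -> U (inv_on U g x) := linear_on_fun lh.
Let kU x : U x -> U (inv_on U f x) := linear_on_fun lk.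

(** The nilpotent part is half of (f - 1) + (g^-1 - 1), whose terms commute. *)
Lemma unip_inv_mean p q : unip_index p U f -> unip_index q U g ->
  unip_index (p + q) U (inv_mean U f g).
Proof.
move=> nf /(unip_inv_on sU isog) nh.
have comm x : U x -> inv_on U g (f x - x) - (f x - x) =
    f (inv_on U g x - x) - (inv_on U g x - x).
  move=> Ux; rewrite (linear_onB lh) ?(linear_onB lf) //; auto.
  rewrite (comm_inv_on sU lf isog fgC Ux) !opprB addrACA [RHS]addrACA.
  by congr (_ + _); exact: addrC.
have nS := nil_index_add sU nf nh comm.
have lS : linear_on U U (fun x => 2%:R^-1 *: x).
  exact/linear_on_scale/linear_on_id.
apply: eq_nil_index (nil_index_comp sU nS lS _) => //.
  move=> x Ux; rewrite /inv_mean /= -[X in _ - X]half_double -scalerBr.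
  by rewrite opprD addrACA.
by move=> x Ux; rewrite (linear_onZ _ sU nS.1).
Qed.

Lemma inv_mean_comm x : U x ->
  inv_mean U f g (inv_mean U g f x) = inv_mean U g f (inv_mean U f g x).
Proof.
move=> Ux; have [Ufx Ugx Uhx Ukx] := And4 (fU Ux) (gU Ux) (hU Ux) (kU Ux).
have Us := subspaceD sU Ugx Ukx; have Ut := subspaceD sU Ufx Uhx.
rewrite /inv_mean (linear_onZ _ sU lf) // (linear_onZ _ sU lh) //.
rewrite (linear_onZ _ sU lg) // (linear_onZ _ sU lk) //.
rewrite (linear_onD lf) // (linear_onD lh) //.
rewrite (linear_onD lg) // (linear_onD lk) //.
rewrite !(inv_onK isof) ?(inv_onK isog) //.
rewrite ?(inv_onKV isof) ?(inv_onKV isog) // fgC //.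
(* Only the commutation of the two inverses is left. *)
congr (_ *: (_ + _ *: (_ + _))).
apply: (iso_inj isof); [by auto|by auto|].
rewrite (inv_onKV isof); last by auto.
rewrite (comm_inv_on sU lf isog fgC) ?(inv_onKV isof) //; auto.
Qed.

End Commuting.
End InvMean.

(** * Conjugation by the Galois involution *)

Lemma gal_act_semilinear (K : fieldType) (L : splittingFieldType K)
    (WK : lmodType K) (tau : gal_of {:L}) (a : L) (x y : base_change L WK) :
  gal_act tau (a *: x + y) = tau a *: gal_act tau x + gal_act tau y.
Proof.
have D (u v : tensor L WK) :
    gal_act tau (u + v) = gal_act tau u + gal_act tau v.
  by rewrite /gal_act raddfD.
rewrite [LHS]D; congr (_ + _).
apply: (tensor_ext
  (g := tens_map (W := WK) (tau : 'End(L)) \o tens_map (W := WK) (amull a))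
  (h := tens_map (W := WK) (amull (tau a)) \o
        tens_map (W := WK) (tau : 'End(L)))) => c w.
by rewrite /= !tens_map_tens /amull /= !lfunE /= rmorphM.
Qed.

Lemma gal_involutive (K : fieldType) (L : splittingFieldType K)
    (tau : gal_of {:L}) :
  galois 1%VS {:L} -> \dim {:L} = 2%N -> tau \in 'Gal({:L} / 1)%g ->
  (tau * tau = 1)%g.
Proof.
move=> gL dL tauG; have := galois_dim gL; rewrite dimv1 divn1 dL => cG.
by have := order_dvdG tauG; rewrite -cG order_dvdn expgS expg1 => /eqP.
Qed.

Section GaloisConjugation.
Variables (K : fieldType) (L : splittingFieldType K) (WK : lmodType K).
Variable tau : gal_of {:L}.
Hypothesis tau2 : (tau * tau = 1)%g.

Notation V := (base_change L WK).
Implicit Types (U : set V) (f g n p : V -> V) (x y : V).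
Notation act := (gal_act tau : V -> V).

Lemma gal_tauK (a : L) : tau (tau a) = a.
Proof. by rewrite -galM ?memvf // tau2 gal_id. Qed.

Lemma gal_actK : involutive act.
Proof.
apply: (tensor_ext (h := idfun)
  (g := tens_map (W := WK) (tau : 'End(L)) \o
        tens_map (W := WK) (tau : 'End(L)))) => c w.
by rewrite /= !tens_map_tens; congr tens; apply: gal_tauK.
Qed.

Lemma gal_conjE f x : gal_conj tau f x = act (f (act x)).
Proof.
rewrite /gal_conj /= (_ : tau^-1 = tau)%g //.
by apply/eqP; rewrite eq_invg_mul tau2.
Qed.

Lemma gal_conjK f : gal_conj tau (gal_conj tau f) = f.
Proof. by apply/funext => x; rewrite !gal_conjE !gal_actK. Qed.

Lemma gal_imageP U y : (act @` U) y <-> U (act y).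
Proof.
split=> [[x Ux <-]|Uy]; first by rewrite gal_actK.
by exists (act y); rewrite ?gal_actK.
Qed.

Lemma gal_imageK U : act @` (act @` U) = U.
Proof. by apply/seteqP; split=> x; rewrite !gal_imageP gal_actK. Qed.

Lemma gal_act0 : act 0 = 0.
Proof. by rewrite /gal_act raddf0. Qed.

Lemma gal_act_scale a x : act (a *: x) = tau a *: act x.
Proof. by rewrite -[a *: x]addr0 gal_act_semilinear gal_act0 addr0. Qed.

Lemma gal_actD x y : act (x + y) = act x + act y.
Proof. by rewrite -[x in LHS]scale1r gal_act_semilinear rmorph1 scale1r. Qed.

Lemma gal_actB x y : act (x - y) = act x - act y.
Proof. by rewrite gal_actD -scaleN1r gal_act_scale rmorphN1 scaleN1r. Qed.

Lemma gal_image_subspace U : subspace U -> subspace (act @` U).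
Proof.
move=> sU; split=> [|a x y /set_mem/gal_imageP Ux /set_mem/gal_imageP Uy];
  apply/mem_set/gal_imageP.
  by rewrite gal_act0; apply: subspace0.
by rewrite gal_act_semilinear; apply: subspaceP.
Qed.

Lemma gal_conj_linear U U' f : linear_on U U' f ->
  linear_on (act @` U) (act @` U') (gal_conj tau f).
Proof.
move=> lf; split=> [x /gal_imageP Ux|a x y].
  by apply/gal_imageP; rewrite gal_conjE gal_actK; apply: linear_on_fun lf _.
move=> /set_mem/gal_imageP Ux /set_mem/gal_imageP Uy.
by rewrite !gal_conjE gal_act_semilinear (linear_onP _ lf) //
  gal_act_semilinear gal_tauK.
Qed.

Lemma gal_conj_iso U U' f : linear_iso_on U U' f ->
  linear_iso_on (act @` U) (act @` U') (gal_conj tau f).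
Proof.
move=> isof; have lc := gal_conj_linear (iso_linear isof).
split=> //; split; first exact: lc.1.
- move=> x y /set_mem/gal_imageP Ux /set_mem/gal_imageP Uy; rewrite !gal_conjE.
  by move/(can_inj gal_actK)/(iso_inj isof Ux Uy)/(can_inj gal_actK).
- move=> y /gal_imageP Uy; have [_ [_ _ fs]] := isof; have [x Ux fx] := fs _ Uy.
  exists (act x); first by apply/gal_imageP; rewrite gal_actK.
  by rewrite gal_conjE gal_actK fx gal_actK.
Qed.

Lemma gal_conj_unip N U f : subspace U -> unip_index N U f ->
  unip_index N (act @` U) (gal_conj tau f).
Proof.
move=> sU [ln nN].
apply: (@eq_nil_index _ _ _ _ (gal_conj tau (fun x => f x - x))).
- exact: gal_image_subspace.
- by move=> x _; rewrite !gal_conjE gal_actB gal_actK.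
split=> [|x /gal_imageP Ux]; first exact: gal_conj_linear.
have -> : iter N (gal_conj tau (fun x => f x - x)) x =
    act (iter N (fun x => f x - x) (act x)).
  by elim: N {nN} => /= [|j ->]; rewrite ?gal_actK // gal_conjE gal_actK.
by rewrite nN // gal_act0.
Qed.

Lemma gal_conj_inv_on U U' f y : subspace U -> linear_iso_on U U' f ->
  (act @` U') y ->
  gal_conj tau (inv_on U f) y = inv_on (act @` U) (gal_conj tau f) y.
Proof.
move=> sU isof /[dup] Uy /gal_imageP Uay; symmetry.
apply: eq_inv_on (gal_conj_iso isof) _ _ _ => //.
  have linv := iso_linear (inv_on_iso sU isof).
  exact: linear_on_fun (gal_conj_linear linv) _.
by rewrite !gal_conjE gal_actK (inv_onKV isof) // gal_actK.
Qed.

(** Since tau fixes 1/2, conjugation commutes with the mean. *)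
Lemma gal_conj_inv_mean U U' p f y : subspace U ->
  linear_iso_on U U' f -> (act @` U') y ->
  gal_conj tau (inv_mean U p f) y =
    inv_mean (act @` U) (gal_conj tau p) (gal_conj tau f) y.
Proof.
move=> sU isof Uy; rewrite /inv_mean -(gal_conj_inv_on sU isof Uy) !gal_conjE.
by rewrite gal_act_scale gal_actD fmorphV rmorph_nat.
Qed.

End GaloisConjugation.

(** * The iteration *)

Section Iteration.
Variables (K : fieldType) (L : splittingFieldType K) (WK : lmodType K).
Variables (tau : gal_of {:L}) (W : bool -> set (base_change L WK)).
Variable phi : bool -> base_change L WK -> base_change L WK.
Hypothesis two_neq0 : 2%:R != 0 :> L.
Hypothesis tau2 : (tau * tau = 1)%g.
Hypothesis subW : forall s, subspace (W s).

Notation act := (gal_act tau : base_change L WK -> base_change L WK).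
Notation phi_ := (phi_iter tau W phi).
Notation psi k s := (gal_conj tau (phi_ k (~~ s))).
Notation W' s := (act @` W (~~ s)).

Let subW' s : subspace (W' s) := gal_image_subspace tau2 (subW (~~ s)).

Lemma phi_iterS k s : phi_ k.+1 s = inv_mean (W' s) (phi_ k s) (psi k s).
Proof. by []. Qed.

Lemma conj_phi_iso k s :
  (forall s, linear_iso_on (W s) (W' s) (phi_ k s)) ->
  linear_iso_on (W' s) (W s) (psi k s).
Proof.
move=> /(_ (~~ s))/(gal_conj_iso tau2).
by rewrite (gal_imageK tau2) negbK.
Qed.

(** The conjugates of the phi_(-s) obey the same recursion as the phi_s, with
    the two members of the pair exchanged. *)
Lemma conj_phi_iterS k s y :
  (forall s, linear_iso_on (W s) (W' s) (phi_ k s)) -> W' s y ->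
  psi k.+1 s y = inv_mean (W s) (psi k s) (phi_ k s) y.
Proof.
move=> isos Wy; have := conj_phi_iso (~~ s) isos => isop.
rewrite phi_iterS (gal_conj_inv_mean tau2 _ (subW' _) isop) //.
by rewrite (gal_imageK tau2) (gal_conjK tau2) negbK.
Qed.

(** The product for the sign -s is the conjugate by tau of the rotated product
    for the sign s, so that unipotency for one sign gives it for the other. *)
Lemma unip_conj_swap N s :
  linear_iso_on (W s) (W' s) (phi s) -> linear_iso_on (W' s) (W s) (psi 0 s) ->
  unip_index N (W s) (psi 0 s \o phi s) ->
  unip_index N (W (~~ s)) (psi 0 (~~ s) \o phi (~~ s)).
Proof.
move=> isof isog /(unip_rotate (subW s) (subW' s) isof (iso_linear isog)).
move=> /(gal_conj_unip tau2 (subW' s)); rewrite (gal_imageK tau2) negbK.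
congr unip_index; apply/funext => x.
by rewrite /= !(gal_conjE tau2) /= (gal_conjE tau2) !(gal_actK tau2).
Qed.

(** Both invariants must be carried together: unipotency at step k is what makes
    the maps of step k.+1 invertible.  The truncated difference makes the
    exponent 1 from step N on. *)
Lemma phi_iter_unip N :
  (forall s, linear_iso_on (W s) (W' s) (phi s)) ->
  (forall s, unip_index (2 ^ N) (W s) (psi 0 s \o phi s)) ->
  forall k, (forall s, linear_iso_on (W s) (W' s) (phi_ k s)) /\
    (forall s, unip_index (2 ^ (N - k)) (W s) (psi k s \o phi_ k s)).
Proof.
move=> iso0 un0; elim=> [|k [isok unk]]; first by rewrite subn0.
have isoS s : linear_iso_on (W s) (W' s) (phi_ k.+1 s).
  exact: (inv_mean_iso two_neq0 (subW s) (subW' s) (isok s)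
    (conj_phi_iso _ isok) (unk s)).
split=> // s.
have un2 : unip_index (2 ^ (N - k.+1)).*2 (W s) (psi k s \o phi_ k s).
  apply: nil_index_le (unk s) => //.
  by rewrite -mul2n -expnS leq_pexp2l // subnS leqSpred.
have := inv_mean_unip two_neq0 (subW s) (subW' s) (isok s)
  (conj_phi_iso _ isok) un2.
apply: eq_nil_index => // x Wx; rewrite /= conj_phi_iterS //.
exact: linear_on_fun (iso_linear (isoS s)) Wx.
Qed.

Lemma phi_iter_stationary k :
  (forall s, linear_iso_on (W s) (W' s) (phi_ k s)) ->
  (forall s x, W s x -> psi k s (phi_ k s x) = x) ->
  forall s x, W s x -> phi_ k.+1 s x = phi_ k s x.
Proof.
move=> isok id1 s x Wx; rewrite phi_iterS /inv_mean.
rewrite (eq_inv_on (h := phi_ k s) (conj_phi_iso _ isok)) ?half_double ?id1 //.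
exact: linear_on_fun (iso_linear (isok s)) Wx.
Qed.

(** The second member of the pair for the sign s is the conjugate of the map for
    the sign -s, so its unipotency comes from the induction hypothesis at -s. *)
Lemma phi_iter_commuting :
  (forall s, W s = W' s) ->
  (forall s x, W s x -> phi s (psi 0 s x) = psi 0 s (phi s x)) ->
  (forall s, exists N, unip_index N (W s) (phi s)) ->
  (forall k s, linear_iso_on (W s) (W' s) (phi_ k s)) ->
  forall k s,
    (forall x, W s x -> phi_ k s (psi k s x) = psi k s (phi_ k s x)) /\
    exists N, unip_index N (W s) (phi_ k s).
Proof.
move=> WW comm0 un0 isos; elim=> [|k IH] s; first by split; auto.
have isof : linear_iso_on (W s) (W s) (phi_ k s) by rewrite {2}WW.
have isog : linear_iso_on (W s) (W s) (psi k s).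
  by rewrite {1}WW; apply/conj_phi_iso/isos.
have phiS x : phi_ k.+1 s x = inv_mean (W s) (phi_ k s) (psi k s) x.
  by rewrite phi_iterS -WW.
have psiS x : W s x -> psi k.+1 s x = inv_mean (W s) (psi k s) (phi_ k s) x.
  by move=> Wx; rewrite conj_phi_iterS // -WW.
have [comm [p unp]] := IH s; have [_ [q unq]] := IH (~~ s).
split=> [x Wx|].
  have Wf : W s (phi_ k.+1 s x).
    by rewrite {1}WW; apply: linear_on_fun (iso_linear (isos _ _)) Wx.
  rewrite (psiS _ Wx) (psiS _ Wf) [phi_ k.+1 s x]phiS [LHS]phiS.
  exact: (inv_mean_comm (subW s) isof isog comm).
have := gal_conj_unip tau2 (subW (~~ s)) unq; rewrite -WW => unq'.
by exists (p + q)%N; rewrite phi_iterS -WW; apply: unip_inv_mean.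
Qed.
End Iteration.

Theorem corollary4p2 (K : fieldType) (L : splittingFieldType K)
    (tau : gal_of {:L}) (WK : lmodType K)
    (W : bool -> set (base_change L WK))
    (phi : bool -> base_change L WK -> base_change L WK)
    (n : base_change L WK -> base_change L WK) :
  2%N \notin [pchar K] ->
  \dim {:L} = 2%N ->
  galois 1%VS {:L} ->
  tau \in 'Gal({:L} / 1)%g ->
  tau != 1%g ->
  (forall s, subspace (W s)) ->
  (forall s, linear_iso_on (W s) (gal_act tau @` W (~~ s)) (phi s)) ->
  nilpotent_on (W true) n ->
  {in W true, gal_conj tau (phi false) \o phi true =1 fun x => x + n x} ->
  let phi_ := phi_iter tau W phi in
  [/\ forall k s, linear_iso_on (W s) (gal_act tau @` W (~~ s)) (phi_ k s),
      exists k0 : nat, forall (k : nat) s, (k0 <= k)%N ->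
        {in W s, phi_ k s =1 phi_ k0 s} /\
        {in W s, gal_conj tau (phi_ k (~~ s)) \o phi_ k s =1 id}
    & forall m : bool -> base_change L WK -> base_change L WK,
      (forall s, W s = gal_act tau @` W (~~ s)) ->
      (forall s, {in W s, phi s \o gal_conj tau (phi (~~ s)) =1
                          gal_conj tau (phi (~~ s)) \o phi s}) ->
      (forall s, nilpotent_on (W s) (m s) /\
                 {in W s, phi s =1 fun x => x + m s x}) ->
      forall k s,
        {in W s, phi_ k s \o gal_conj tau (phi_ k (~~ s)) =1
                 gal_conj tau (phi_ k (~~ s)) \o phi_ k s} /\
        exists mk : base_change L WK -> base_change L WK,
          nilpotent_on (W s) mk /\ {in W s, phi_ k s =1 fun x => x + mk x}].
Proof.
move=> char2 dimL galL tauG _ subW iso0 nil_n en phi_.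
have two_neq0 : 2%:R != 0 :> L.
  by move: char2; rewrite -(pchar_lalg L) inE.
have tau2 := gal_involutive galL dimL tauG.
have subW' s := gal_image_subspace tau2 (subW (~~ s)).
pose psi k s := gal_conj tau (phi_ k (~~ s)).
have [N unT] : exists N, unip_index N (W true) (psi 0 true \o phi true).
  have /nilpotent_onP[N nN] := nil_n; exists N.
  apply: eq_nil_index nN => // x Wx.
  by rewrite [_ x](en _ (mem_set Wx)) addrC addKr.
have unF : unip_index N (W false) (psi 0 false \o phi false).
  exact: unip_conj_swap (conj_phi_iso tau2 (k := 0) _ iso0) unT.
have un0 s : unip_index (2 ^ N) (W s) (psi 0 s \o phi s).
  by apply: nil_index_le (ltnW (ltn_expl N (ltnSn 1))) _; case: s.
have inv := phi_iter_unip two_neq0 tau2 subW iso0 un0.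
have isos k s := (inv k).1 s.
split=> //.
  have id1 k s x : (N <= k)%N -> W s x -> psi k s (phi_ k s x) = x.
    move=> Nk Wx; have [_ /(_ s)[_ /(_ x Wx)]] := inv k.
    by rewrite (eqP Nk) => /subr0_eq.
  (* The exponent N is at most 2 ^ N, and is exhausted after N halvings. *)
  exists N => k s Nk; split=> x /set_mem Wx; last exact: id1.
  rewrite -(subnKC Nk); elim: (k - N)%N => [|j IH]; first by rewrite addn0.
  rewrite addnS -IH; apply: (phi_iter_stationary two_neq0 tau2) => // s' y.
  by apply: id1; apply: leq_addr.
move=> m WW comm unm k s.
have comm0 s' x : W s' x -> phi s' (psi 0 s' x) = psi 0 s' (phi s' x).
  by move=> Wx; exact: (comm s' _ (mem_set Wx)).
have unphi s' : exists p, unip_index p (W s') (phi s').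
  have [/nilpotent_onP[p np] E] := unm s'; exists p.
  by apply: eq_nil_index np => // x Wx; rewrite E ?mem_set // addrC addKr.
have [commk /nilpotent_onP nk] :=
  phi_iter_commuting two_neq0 tau2 subW WW comm0 unphi isos k s.
split=> [x /set_mem|]; first exact: commk.
by exists (fun x => phi_ k s x - x); split=> // x _; rewrite addrC subrK.
Qed.
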